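(* For every $p\in(0,3)$, the inequality $$\mathsf{E}f(S)\le\mathsf{E}f\big(\Gamma_{(1-\varepsilon)\sigma^2}+y\tilde\Pi_{\varepsilon\sigma^2/y^2}\big)$$ (which holds for all $f\in\mathcal{H}_+^3$ whenever $\sigma,y,\beta>0$, $\varepsilon:=\frac{\beta}{\sigma^2y}\in(0,1)$, and $S=X_1+\dots+X_n$ for independent $X_1,\dots,X_n$ with $\sum_i\mathsf{E}X_i^2\le\sigma^2$, $\sum_i\mathsf{E}(X_i)_+^3\le\beta$, and $\mathsf{E}X_i\le0$, $X_i\le y$ a.s. for all $i$) does not hold in general with $\mathcal{H}_+^3$ replaced by the larger class $\mathcal{H}_+^p$, not even for $n=1$. That is, for every $p\in(0,3)$ there exist positive real $\sigma,y,\beta$ with $\varepsilon:=\frac{\beta}{\sigma^2y}\in(0,1)$, a random variable $X_1$ with $\mathsf{E}X_1^2\le\sigma^2$, $\mathsf{E}(X_1)_+^3\le\beta$, $\mathsf{E}X_1\le0$ and $X_1\le y$ a.s., and a function $f\in\mathcal{H}_+^p$ such that $$\mathsf{E}f(X_1)>\mathsf{E}f\big(\Gamma_{(1-\varepsilon)\sigma^2}+y\tilde\Pi_{\varepsilon\sigma^2/y^2}\big).$$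
   Context: Notation: $x_+:=\max(0,x)$ and $x_+^\alpha:=(x_+)^\alpha$. For $a>0$ and $\theta>0$, $\Gamma_{a^2}$ and $\Pi_\theta$ denote independent random variables with $\Gamma_{a^2}\sim N(0,a^2)$ (normal) and $\Pi_\theta\sim\mathrm{Pois}(\theta)$ (Poisson), and $\tilde\Pi_\theta:=\Pi_\theta-\theta$. For $\alpha>0$, $\mathcal{H}_+^\alpha$ is the class of all functions $f\colon\mathbb{R}\to\mathbb{R}$ for which there is a nonnegative Borel measure $\mu$ on $\mathbb{R}$ such that $f(u)=\int_{-\infty}^\infty(u-t)_+^\alpha\,\mu(dt)$ for all $u\in\mathbb{R}$. One has $\mathcal{H}_+^\alpha\subseteq\mathcal{H}_+^\beta$ whenever $0<\beta<\alpha$. *)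

(* Defs.v *)
From HB Require Import structures.
From mathcomp Require Import all_boot all_order all_algebra.
From mathcomp Require Import all_classical all_reals all_analysis.

Set Implicit Arguments.
Unset Strict Implicit.
Unset Printing Implicit Defensive.

Import Order.TTheory GRing.Theory Num.Theory.
Import numFieldNormedType.Exports.

Local Open Scope classical_set_scope.
Local Open Scope ring_scope.

Definition pospart (R : realType) (x : R) : R := Num.max 0 x.

(* The measure is an arbitrary Borel measure, not assumed finite or sigma-finite;
   that the integral is finite for every u is part of the equation, f being
   real-valued. *)
Definition Hplus (R : realType) (alpha : R) : set (R -> R) :=
  [set f | exists mu : {measure set (measurableTypeR R) -> \bar R},
    forall u : R, (f u)%:E = (\int[mu]_t (pospart (u - t) `^ alpha)%:E)%E].

Definition has_law (d d' : measure_display) (T : measurableType d)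
    (T' : measurableType d') (R : realType) (P : probability T R)
    (X : {RV P >-> T'}) (mu : set T' -> \bar R) : Prop :=
  forall A : set T', measurable A -> distribution P X A = mu A.

(* normal_prob takes the standard deviation, hence the square root. *)
Definition is_normal0 (d : measure_display) (T : measurableType d)
    (R : realType) (P : probability T R) (G : {RV P >-> R}) (var : R) : Prop :=
  has_law G (normal_prob 0 (Num.sqrt var)).

(* The second argument of poisson_prob is not used by its definition. *)
Definition is_poisson (d : measure_display) (T : measurableType d)
    (R : realType) (P : probability T R) (N : {RV P >-> nat}) (theta : R) :
    Prop :=
  has_law N (poisson_prob theta 0%N).

Definition independent_RV (d d1 d2 : measure_display) (T : measurableType d)
    (T1 : measurableType d1) (T2 : measurableType d2) (R : realType)
    (P : probability T R) (X : {RV P >-> T1}) (Y : {RV P >-> T2}) : Prop :=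
  forall (A : set T1) (B : set T2), measurable A -> measurable B ->
    P (X @^-1` A `&` Y @^-1` B) = (P (X @^-1` A) * P (Y @^-1` B))%E.

(* Main.v *)
Require Import Defs.
From HB Require Import structures.
From mathcomp Require Import all_boot all_order all_algebra.
From mathcomp Require Import all_classical all_reals all_analysis.
From mathcomp Require Import measurable_realfun zify ring lra.

Import Order.TTheory GRing.Theory Num.Theory.
Import numFieldNormedType.Exports.

Local Open Scope classical_set_scope.
Local Open Scope ring_scope.

(** Fix a unit jump size [y = 1] and a small [b > 0]. Let [X] be the centred
variable taking the value [1] with probability [b] and the value [- b / (1 - b)]
with probability [1 - b]; then [E X^2 = b / (1 - b)] and [E X_+^3 = b], so all
the moment constraints are saturated by [sigma^2 = b / (1 - b)] and [beta = b].
With this choice [eps = 1 - b], the Poisson parameter is [b], and the Gaussian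
variance is [b^2 / (1 - b)], that is, the Gaussian part is of size [b].

The test function is [f u = (u - t)_+^p], generated by the Dirac mass at [t],
for a small fixed threshold [t > 0]. Writing [s = 1 - t], one has
[E f(X) = b s^p] exactly, whereas expanding in the number of Poisson jumps gives
[E f(G + N - b) = b s^p + b^2 ((1 + s)^p / 2 - s^p - p s^(p - 1)) + O(b^3)]:
no jump contributes almost nothing because the Gaussian would have to exceed
[t], which is far away on its scale [b]; one jump occurs with probability
[b - b^2] and lands near [s - b]; two jumps occur with probability [b^2 / 2] and
land near [1 + s]. As [t] tends to [0] the coefficient of [b^2] tends to
[2^(p - 1) - 1 - p]. Its negativity, [2^p < 2 + 2 p], holds on [(0, 3)] by
convexity of the exponential, and turns into an equality at [p = 3], the exponent
for which the inequality under discussion is true.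

Everything is made effective through one inequality,
[z_+^p <= c^p exp (p (z / c - 1))] for every [c > 0] ([pospart_powR_le]): it is
sharp to first order at [z = c], so integrating it against the Gaussian, whose
exponential moments are explicit, yields both the linear correction
[- p b s^(p - 1)] after one jump and, with [c] of order [b], the negligibility
of the term without jump ([normal_pospart_powR_le]). The resulting bound on the
Poisson series is [poisson_normal_le], and [small_jump_gain] compares it with
[b s^p]. The random variables are coordinates on a triple product space. *)

(** * Choice of the threshold *)

(** The chord of the convex function [q |-> 8^q] over [0, 1] gives
[2^p <= 1 + 7 p / 3] with [q = p / 3], and this is below [2 + 2 p] when
[p < 3]. *)
Lemma powR2_lt {R : realType} {p : R} : 0 < p -> p < 3 -> 2 `^ p < 2 + 2 * p.
Proof.
move=> p0 p3.
have q01 : Itv.spec (@Itv.num_sem R) (Itv.Real `[0%Z, 1%Z]) (p / 3).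
  rewrite /= /Itv.num_sem /= in_itv/= num_real/=; apply/andP; split; lra.
have := convex_expR (Itv.mk q01) (ln 8) 0.
rewrite !convRE /= mulr0 addr0 expR0 mulr1 lnK ?posrE// /unstable.onem.
rewrite (_ : p / 3 * ln 8 = p * ln 2); last first.
  by rewrite (_ : 8 = 2 ^+ 3) ?lnXn//; [field|ring].
rewrite /powR gt_eqF//; lra.
Qed.

(** The strict inequality [2^(p - 1) < 1 + p] survives multiplication of its
right-hand side by [(1 - t)^p] for small [t]; the explicit [t] comes from
[(1 - t)^p >= (1 - t)^3 >= 1 - 3 t], which costs only half of the relative
gap [6 t]. *)
Lemma exists_threshold {R : realType} {p : R} : 0 < p -> p < 3 ->
  exists t : R, [/\ 0 < t, t <= 2^-1 & 2 `^ p / 2 < (1 - t) `^ p * (1 + p)].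
Proof.
move=> p0 p3; have D := powR2_lt p0 p3.
have D0 : 0 < 2 `^ p :> R by rewrite powR_gt0.
set q := 2 `^ p in D D0 *.
have t0 : 0 < (1 - q / (2 + 2 * p)) / 6.
  by rewrite divr_gt0// subr_gt0 ltr_pdivrMr; lra.
have q0 : 0 < q / (2 + 2 * p) by rewrite divr_gt0//; lra.
exists ((1 - q / (2 + 2 * p)) / 6); set t := _ / 6 in t0 *.
have qt : q = (1 - 6 * t) * (2 + 2 * p) by rewrite /t; field; lra.
split=> //; first by rewrite /t; lra.
have tl : t <= 6^-1 by rewrite /t; lra.
have : (1 - t) ^+ 3 <= (1 - t) `^ p.
  rewrite -powR_mulrn; last lra.
  by rewrite ger_powR//; lra.
have : 1 - 3 * t <= (1 - t) ^+ 3.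
  rewrite (_ : (1 - t) ^+ 3 = 1 - 3 * t + t * t * (3 - t)); last ring.
  nra.
move=> h1 h2.
have : (1 - 3 * t) * (1 + p) <= (1 - t) `^ p * (1 + p).
  by rewrite ler_wpM2r//; lra.
rewrite qt; nra.
Qed.

(** * Gaussian and Poisson integrals *)

(** From [x <= exp (x - 1)] at [x = z / c]. The bound is tangent to [z_+^p] at
[z = c], and [c] is free: this replaces a second-order Taylor estimate near a
jump and a tail estimate away from the jumps. *)
Lemma pospart_powR_le {R : realType} {p c : R} (z : R) : 0 < p -> 0 < c ->
  pospart z `^ p <= c `^ p * expR (p * (z / c - 1)).
Proof.
move=> p0 c0; rewrite /pospart.
have [z0|z0] := leP z 0.
  by rewrite powR0 ?gt_eqF// mulr_ge0 ?powR_ge0 ?expR_ge0.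
rewrite {1}(_ : z = c * (z / c)); last by rewrite mulrCA divff ?mulr1 ?gt_eqF.
have zc : 0 <= z / c by rewrite divr_ge0 ?ltW.
rewrite powRM ?(ltW c0)// ler_wpM2l ?powR_ge0//.
have -> : expR (p * (z / c - 1)) = expR (z / c - 1) `^ p.
  by rewrite /powR gt_eqF ?expR_gt0// expRK.
rewrite ge0_ler_powR ?nnegrE ?expR_ge0 ?(ltW p0)//.
have := expR_ge1Dx (z / c - 1); lra.
Qed.

Lemma measurable_pospart_powR d (T : measurableType d) (R : realType) (p : R)
    (f : T -> R) :
  measurable_fun setT f -> measurable_fun setT (fun x => pospart (f x) `^ p).
Proof.
move=> mf.
apply: (measurableT_comp (measurable_powR p)).
exact: measurable_maxr.
Qed.

Lemma measurable_payoff d (T : measurableType d) (R : realType) (p b t : R)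
    (G : T -> R) (N : T -> nat) :
  measurable_fun setT G -> measurable_fun setT N ->
  measurable_fun setT
    (fun w => (pospart (G w + ((N w)%:R - b) - t) `^ p)%:E).
Proof.
move=> mG mN; apply/measurable_EFinP; apply: measurable_pospart_powR.
apply: measurable_funB => //; apply: measurable_funD => //.
apply: measurable_funB => //.
exact: (@measurableT_comp _ _ _ _ _ _ (fun n : nat => n%:R : R)).
Qed.

Lemma integral_normal_prob (R : realType) (m s : R) (f : R -> \bar R) :
  measurable_fun [set: R] f -> (forall x, 0 <= f x)%E ->
  (\int[normal_prob m s]_x f x =
   \int[@lebesgue_measure R]_x (f x * (normal_pdf m s x)%:E))%E.
Proof.
move=> mf f0.
have dom := normal_prob_dominates m s.
rewrite -(Radon_Nikodym_SigmaFinite.change_of_variables dom)//.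
apply: ae_eq_integral => //.
- apply: emeasurable_funM => //; apply: (measurable_int lebesgue_measure).
  exact: Radon_Nikodym_SigmaFinite.f_integrable.
- apply: emeasurable_funM => //; apply/measurable_EFinP.
  exact: measurable_normal_pdf.
- apply: ae_eqe_mul2l => /=.
  apply: integral_ae_eq => //=.
  + exact: Radon_Nikodym_SigmaFinite.f_integrable.
  + by apply/measurable_EFinP; exact: measurable_normal_pdf.
  + by move=> E _ mE; rewrite -Radon_Nikodym_SigmaFinite.f_integral.
Qed.

(** Tilting the centred normal density by [exp (l x)] gives, up to the constant
[exp (l^2 s^2 / 2)], the normal density with mean [l s^2]. *)
Lemma normal_mgf (R : realType) (s l : R) : s != 0 ->
  (\int[normal_prob 0 s]_x (expR (l * x))%:E = (expR (l ^+ 2 * s ^+ 2 / 2))%:E)%E.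
Proof.
move=> s0; rewrite integral_normal_prob; last 2 first.
- by apply/measurable_EFinP; apply: measurableT_comp => //; exact: measurable_funM.
- by move=> x; rewrite lee_fin expR_ge0.
transitivity (\int[@lebesgue_measure R]_x
   ((expR (l ^+ 2 * s ^+ 2 / 2))%:E * (normal_pdf (l * s ^+ 2) s x)%:E))%E.
  apply: eq_integral => x _; rewrite -!EFinM !normal_pdfE//; congr (_%:E).
  rewrite /normal_fun mulrCA [RHS]mulrCA -!expRD; congr (_ * expR _).
  by field.
rewrite ge0_integralZl//; last 2 first.
- by apply/measurable_EFinP; exact: measurable_normal_pdf.
- by move=> x _; rewrite lee_fin normal_pdf_ge0.
by rewrite integral_normal_pdf mule1.
Qed.

Lemma normal_pospart_powR_le {R : realType} {p c : R} (m : R) {s : R} :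
  0 < p -> 0 < c -> s != 0 ->
  (\int[normal_prob 0 s]_x (pospart (x + m) `^ p)%:E <=
   (c `^ p * expR (p * (m / c - 1) + (p / c) ^+ 2 * s ^+ 2 / 2))%:E)%E.
Proof.
move=> p0 c0 s0.
apply: (@le_trans _ _ (\int[normal_prob 0 s]_x
   ((c `^ p * expR (p * (m / c - 1)))%:E * (expR (p / c * x))%:E))%E).
  apply: ge0_le_integral => //.
  - by move=> x _; rewrite lee_fin powR_ge0.
  - apply/measurable_EFinP; apply: measurable_pospart_powR.
    exact: measurable_funD.
  - apply: emeasurable_funM => //; apply/measurable_EFinP.
    by apply: measurableT_comp => //; exact: measurable_funM.
  - move=> x _; rewrite -EFinM lee_fin.
    apply: (le_trans (pospart_powR_le _ p0 c0)).
    rewrite -[leRHS]mulrA -expRD ler_wpM2l ?powR_ge0// ler_expR.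
    rewrite le_eqVlt; apply/orP; left; apply/eqP; field; lra.
rewrite ge0_integralZl//.
- rewrite normal_mgf// -EFinM lee_fin -[leLHS]mulrA -expRD.
  by rewrite mulrA.
- by apply/measurable_EFinP; apply: measurableT_comp => //; exact: measurable_funM.
- by rewrite lee_fin mulr_ge0 ?powR_ge0 ?expR_ge0.
Qed.

(** The Poisson law is a countable sum of weighted Dirac masses. *)
Lemma integral_poisson_prob {R : realType} {b : R} (k : nat) (f : nat -> \bar R) :
  0 < b -> (forall x, 0 <= f x)%E ->
  (\int[poisson_prob b k]_x f x =
   \sum_(i <oo) (poisson_pmf b i)%:E * f i)%E.
Proof.
move=> b0 f0.
pose m_ := fun i => mscale (NngNum (poisson_pmf_ge0 b i)) (@dirac _ nat i R).
transitivity (\int[mseries m_ 0]_x f x)%E.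
  apply: eq_measure_integral => /= A mA _.
  rewrite /poisson_prob b0 /mseries.
  rewrite -{1}(set_mem_set A) -nneseries_esum; last first.
    by move=> *; rewrite lee_fin poisson_pmf_ge0.
  rewrite eseries_mkcond; apply: eq_eseriesr => i _.
  transitivity ((poisson_pmf b i)%:E * \d_i A)%E => //.
  by rewrite diracE; case: (i \in A); rewrite ?mule1 ?mule0.
rewrite ge0_integral_measure_series//; apply: eq_eseriesr => i _.
by rewrite ge0_integral_mscale//= integral_dirac//= diracT mul1e.
Qed.

(** Tailored to the expansion in the number of jumps, where only the first three
terms matter. *)
Lemma nneseries_le_geometric_tail (R : realType) (u : nat -> \bar R) (w0 w1 w2 C : R) :
  0 <= C -> (forall k, 0 <= u k)%E ->
  (u 0%N <= w0%:E)%E -> (u 1%N <= w1%:E)%E -> (u 2%N <= w2%:E)%E ->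
  (forall j, u j.+3 <= (C * 2^-1 ^+ j)%:E)%E ->
  (\sum_(k <oo) u k <= (w0 + w1 + w2 + 2 * C)%:E)%E.
Proof.
move=> C0 u0 h0 h1 h2 h3.
have partial n : (\sum_(0 <= k < n.+3) u k <=
    (w0 + w1 + w2 + 2 * C - 2 * C * 2^-1 ^+ n)%:E)%E.
  (* the subtracted term is exactly the remaining geometric tail *)
  elim: n => [|n ih].
    rewrite !big_nat_recr//= big_nil add0e.
    apply: (le_trans (leeD (leeD h0 h1) h2)).
    by rewrite -!EFinD lee_fin expr0 mulr1 addrK.
  rewrite big_nat_recr//=; apply: (le_trans (leeD ih (h3 n))).
  rewrite -EFinD lee_fin exprS; lra.
apply: lime_le; first by apply: is_cvg_ereal_nneg_natsum => k _.
exists 3%N => // n /= n3; rewrite -(subnK n3) addn3.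
apply: (le_trans (partial _)); rewrite lee_fin gerBl.
by rewrite !mulr_ge0// exprn_ge0// invr_ge0.
Qed.

Lemma expn3_le (j : nat) : (j.+3 ^ 3 <= 3 ^ j.+3)%N.
Proof.
elim: j => [|j ih]; first by [].
rewrite [leqRHS]expnS; apply: leq_trans (leq_mul (leqnn 3) ih).
rewrite !expnS !expn0; nia.
Qed.

(** * Expansion in the number of Poisson jumps *)

Lemma expR_le1D2x {R : realType} (x : R) :
  0 <= x -> x <= 2^-1 -> expR x <= 1 + 2 * x.
Proof.
move=> x0 x2; have x1 : 0 < 1 - x by lra.
apply: (@le_trans _ _ (1 - x)^-1); last first.
  by rewrite -div1r ler_pdivrMr//; nra.
rewrite -[leLHS]invrK lef_pV2 ?posrE ?invr_gt0 ?expR_gt0// -expRN.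
exact: expR_ge1Dx.
Qed.

(** Value after at least one jump, [c] being the height of the jumps above the
threshold. The Gaussian contributes only at second order since its variance is
at most [2 b^2] and [p / c <= 6]. *)
Lemma normal_jump_le (R : realType) (p b c : R) :
  0 < p -> p < 3 -> 0 < b -> b <= 2^-1 -> 2^-1 <= c ->
  (\int[normal_prob 0 (Num.sqrt (b ^+ 2 / (1 - b)))]_x
     (pospart (x + (c - b)) `^ p)%:E <=
   (c `^ p * expR (- (p * b / c) + 36 * b ^+ 2))%:E)%E.
Proof.
move=> p0 p3 b0 b2 c2.
have v0 : 0 < b ^+ 2 / (1 - b) by rewrite divr_gt0 ?exprn_gt0//; lra.
have v2 : b ^+ 2 / (1 - b) <= 2 * b ^+ 2.
  rewrite ler_pdivrMr; last lra.
  nra.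
have c0 : 0 < c by lra.
apply: (le_trans (normal_pospart_powR_le _ p0 c0 _)).
  by rewrite gt_eqF// sqrtr_gt0.
rewrite lee_fin ler_wpM2l ?powR_ge0// ler_expR sqr_sqrtr ?(ltW v0)//.
have -> : p * ((c - b) / c - 1) = - (p * b / c) by field; lra.
rewrite lerD2l -mulrA.
have pc : p / c <= 6 by rewrite ler_pdivrMr//; lra.
have pc2 : (p / c) ^+ 2 <= 36.
  have -> : 36 = 6 ^+ 2 :> R by rewrite expr2; lra.
  by rewrite ler_pXn2r// nnegrE ?divr_ge0// ltW.
apply: ler_pM => //; first exact: sqr_ge0.
  by rewrite divr_ge0// ltW.
lra.
Qed.

(** Without jump the Gaussian must exceed the fixed level [t], that is, deviate by
about [t / b] standard deviations; the choice [c = p b] in the exponential bound gives a factor [exp (- t / b)],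
which a cubic lower bound on [exp] turns into [O(b^3)]. *)
Lemma normal_nojump_le (R : realType) (p t b : R) :
  0 < p -> 0 < t -> 0 < b -> b <= 2^-1 -> p * b <= 1 ->
  (\int[normal_prob 0 (Num.sqrt (b ^+ 2 / (1 - b)))]_x
     (pospart (x + (- b - t)) `^ p)%:E <= (6 * b ^+ 3 / t ^+ 3)%:E)%E.
Proof.
move=> p0 t0 b0 b2 pb1.
have v0 : 0 < b ^+ 2 / (1 - b) by rewrite divr_gt0 ?exprn_gt0//; lra.
have c0 : 0 < p * b by rewrite mulr_gt0.
apply: (le_trans (normal_pospart_powR_le _ p0 c0 _)).
  by rewrite gt_eqF// sqrtr_gt0.
rewrite lee_fin sqr_sqrtr ?(ltW v0)//.
have -> : p * ((- b - t) / (p * b) - 1) +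
    (p / (p * b)) ^+ 2 * (b ^+ 2 / (1 - b)) / 2 = - (t / b) + ((2 * (1 - b))^-1 - 1 - p).
  field; apply/and3P; split; lra.
have v1 : (2 * (1 - b))^-1 <= 1 by rewrite invf_le1; lra.
apply: (@le_trans _ _ (1 * expR (- (t / b)))).
  apply: ler_pM; rewrite ?powR_ge0 ?expR_ge0//.
    have <- : 1 `^ p = 1 :> R by rewrite powR1.
    by rewrite ge0_ler_powR ?nnegrE// ltW.
  by rewrite ler_expR; lra.
rewrite mul1r expRN.
have -> : 6 * b ^+ 3 / t ^+ 3 = ((t / b) ^+ 3 / 6)^-1.
  by field; apply/andP; split; lra.
have tb0 : 0 < t / b by rewrite divr_gt0.
rewrite lef_pV2 ?posrE ?expR_gt0 ?divr_gt0 ?exprn_gt0//.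
have := expR_ge1Dxn 2 (ltW tb0).
rewrite (_ : 3`!%:R = 6 :> R)//; lra.
Qed.

(** The summands correspond to zero, one, two, and at least three jumps. In the
last case the growth [k^p <= 3^k] is absorbed by the factor [b^k / k!], whence
a geometric series of ratio [3 b <= 1/2] starting at order [b^3]. *)
Lemma poisson_normal_le {R : realType} {p t b : R} (n : nat) :
  0 < p -> p < 3 -> 0 < t -> t <= 2^-1 -> 0 < b -> b <= 40^-1 ->
  (\int[poisson_prob b n]_k \int[normal_prob 0 (Num.sqrt (b ^+ 2 / (1 - b)))]_x
     (pospart (x + (k%:R - b) - t) `^ p)%:E <=
   (expR (- b) * (6 * b ^+ 3 / t ^+ 3
     + b * ((1 - t) `^ p * expR (- (p * b) + 36 * b ^+ 2))
     + b ^+ 2 / 2 * (2 `^ p * expR (36 * b ^+ 2)) + 18 * b ^+ 3))%:E)%E.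
Proof.
move=> p0 p3 t0 t2 b0 b40.
have eb0 : 0 <= expR (- b) by rewrite expR_ge0.
have pb0 : 0 < p * b by rewrite mulr_gt0.
pose J (k : nat) := (\int[normal_prob 0 (Num.sqrt (b ^+ 2 / (1 - b)))]_x
  (pospart (x + (k%:R - b) - t) `^ p)%:E)%E.
have J0 k : (0 <= J k)%E by apply: integral_ge0 => x _; rewrite lee_fin powR_ge0.
rewrite (integral_poisson_prob _ J)// /poisson_pmf b0.
have jump (k : nat) : (0 < k)%N ->
    (J k <= ((k%:R - t) `^ p * expR (- (p * b / (k%:R - t)) + 36 * b ^+ 2))%:E)%E.
  move=> k0; have k1 : 1 <= k%:R :> R by rewrite ler1n.
  rewrite /J; under eq_integral do rewrite -addrA addrAC.
  by apply: normal_jump_le => //; lra.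
have term (k : nat) (M : R) : (J k <= M%:E)%E ->
    ((b ^+ k / k`!%:R * expR (- b))%:E * J k <=
     (expR (- b) * (b ^+ k / k`!%:R * M))%:E)%E.
  move=> JM; rewrite [leRHS](_ : _ = (b ^+ k / k`!%:R * expR (- b))%:E * M%:E)%E.
    by apply: lee_wpmul2l => //; rewrite lee_fin !mulr_ge0// exprn_ge0// ltW.
  by rewrite -EFinM; congr _%:E; ring.
rewrite [leRHS](_ : _ = (expR (- b) * (b ^+ 0 / 0`!%:R * (6 * b ^+ 3 / t ^+ 3))
  + expR (- b) * (b ^+ 1 / 1`!%:R * ((1 - t) `^ p * expR (- (p * b) + 36 * b ^+ 2)))
  + expR (- b) * (b ^+ 2 / 2`!%:R * (2 `^ p * expR (36 * b ^+ 2)))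
  + 2 * (expR (- b) * (9 * b ^+ 3)))%:E); last first.
  congr _%:E.
  by rewrite (_ : 0`! = 1)%N// (_ : 1`! = 1)%N// (_ : 2`! = 2)%N//; field; lra.
have e36 : expR (36 * b ^+ 2) <= 2.
  have bb : b ^+ 2 <= b / 40 by rewrite expr2; nra.
  have := expR_le1D2x (36 * b ^+ 2).
  by rewrite mulr_ge0 ?sqr_ge0//; lra.
apply: nneseries_le_geometric_tail.
- by rewrite mulr_ge0// mulr_ge0// exprn_ge0// ltW.
- by move=> k; rewrite mule_ge0// lee_fin !mulr_ge0// exprn_ge0// ltW.
- apply: term; rewrite /J.
  under eq_integral do rewrite sub0r -addrA.
  apply: normal_nojump_le => //; first lra.
  nra.
- apply: term; apply: (le_trans (jump 1%N isT)).
  rewrite lee_fin ler_wpM2l ?powR_ge0// ler_expR lerD2r lerN2.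
  rewrite ler_pdivlMr; last lra.
  nra.
- apply: term; apply: (le_trans (jump 2%N isT)).
  rewrite lee_fin; apply: ler_pM; rewrite ?powR_ge0 ?expR_ge0//.
    by rewrite ge0_ler_powR ?nnegrE//; lra.
  rewrite ler_expR gerDr oppr_le0 divr_ge0//; lra.
- move=> j; apply: (le_trans (term _ _ (jump j.+3 isT))).
  rewrite lee_fin -[leRHS]mulrA ler_wpM2l//.
  have k3 : 3 <= j.+3%:R :> R by rewrite ler_nat.
  have powk : (j.+3%:R - t) `^ p <= 3 ^+ j.+3.
    apply: (@le_trans _ _ (j.+3%:R `^ p)).
      by rewrite ge0_ler_powR ?nnegrE//; lra.
    apply: (@le_trans _ _ (j.+3%:R `^ 3)).
      by rewrite ler_powR//; lra.
    by rewrite powR_mulrn// -!natrX ler_nat expn3_le.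
  have expk : expR (- (p * b / (j.+3%:R - t)) + 36 * b ^+ 2) <= 2.
    apply: le_trans e36; rewrite ler_expR gerDr oppr_le0 divr_ge0//; lra.
  have factk : b ^+ j.+3 / j.+3`!%:R <= b ^+ j.+3 / 6.
    rewrite ler_pM2l ?exprn_gt0// lef_pV2 ?posrE ?ltr0n ?fact_gt0//.
    by rewrite (_ : 6 = 3`!%:R :> R)// ler_nat leq_fact.
  apply: (@le_trans _ _ (b ^+ j.+3 / 6 * (3 ^+ j.+3 * 2))).
    apply: ler_pM => //.
    + by rewrite divr_ge0// exprn_ge0// ltW.
    + by rewrite mulr_ge0 ?powR_ge0 ?expR_ge0.
    + by rewrite ler_pM ?powR_ge0 ?expR_ge0.
  rewrite (_ : b ^+ j.+3 / 6 * (3 ^+ j.+3 * 2) =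
               9 * b ^+ 3 * (3 * b) ^+ j); last first.
    by rewrite -[j.+3]addn3 !exprD exprMn; field.
  rewrite ler_wpM2l ?mulr_ge0 ?exprn_ge0// ?(ltW b0)//.
  by rewrite lerXn2r ?nnegrE//; lra.
Qed.

(** The comparison is made after multiplying by [exp b]. The left-hand side then
loses [A (1 + p) b^2] to first order from one jump and wins [2^p b^2 / 2] from
two; [d] is the net loss per unit of [b^2], and [354] collects the constants in the cubic
remainders, using [A <= 1] and [2^p <= 8]. *)
Lemma small_jump_gain (R : realType) (p t b : R) :
  let A := (1 - t) `^ p in
  let d := A * (1 + p) - 2 `^ p / 2 in
  0 < p -> p < 3 -> 0 < t -> t < 1 -> 0 < b -> b <= 40^-1 ->
  (6 / t ^+ 3 + 354) * b < d ->
  expR (- b) * (6 * b ^+ 3 / t ^+ 3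
     + b * (A * expR (- (p * b) + 36 * b ^+ 2))
     + b ^+ 2 / 2 * (2 `^ p * expR (36 * b ^+ 2)) + 18 * b ^+ 3) < b * A.
Proof.
move=> A d p0 p3 t0 t1 b0 b40 bd.
rewrite expRN mulrC ltr_pdivrMr ?expR_gt0//.
have A1 : A <= 1.
  have <- : 1 `^ p = 1 :> R by rewrite powR1.
  by rewrite ge0_ler_powR ?nnegrE//; lra.
have A0 : 0 < A by rewrite powR_gt0; lra.
have D8 : 2 `^ p <= 8.
  apply: (@le_trans _ _ (2 `^ 3)).
    by rewrite ler_powR//; lra.
  by rewrite powR_mulrn// -natrX ler_nat.
have D0 : 0 < 2 `^ p :> R by rewrite powR_gt0.
set D := 2 `^ p in d bd D8 D0 *.
have bb : b ^+ 2 <= b / 40 by rewrite expr2; nra.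
have bb0 : 0 < b ^+ 2 by rewrite exprn_gt0.
have E72 : expR (36 * b ^+ 2) <= 1 + 72 * b ^+ 2.
  have := expR_le1D2x (36 * b ^+ 2).
  by rewrite mulr_ge0 ?(ltW bb0)//; lra.
(* [exp b - E0] is bounded below through the ratio [exp b / E0], by means of
   [1 + x <= exp x] alone *)
set E0 := expR (- (p * b) + 36 * b ^+ 2).
have eb : E0 * (1 + ((1 + p) * b - 36 * b ^+ 2)) <= expR b.
  rewrite [leRHS](_ : _ = E0 * expR ((1 + p) * b - 36 * b ^+ 2)).
    by rewrite ler_wpM2l ?expR_ge0// expR_ge1Dx.
  by rewrite -expRD; congr expR; ring.
have E01 : 1 - 3 * b <= E0.
  by apply: le_trans (expR_ge1Dx _); nra.
have H1 : (1 - 3 * b) * ((1 + p) * b - 36 * b ^+ 2) <= expR b - E0.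
  apply: (@le_trans _ _ (E0 * ((1 + p) * b - 36 * b ^+ 2))); last by lra.
  by rewrite ler_wpM2r//; nra.
have H2 : (1 + p) - 48 * b <= (1 - 3 * b) * ((1 + p) - 36 * b) by nra.
have H3 : b * ((1 + p) - 48 * b) <= expR b - E0.
  apply: le_trans H1.
  rewrite [leRHS](_ : _ = b * ((1 - 3 * b) * ((1 + p) - 36 * b))); last ring.
  by rewrite ler_wpM2l// ltW.
have H4 : A * (b * ((1 + p) - 48 * b)) <= A * expR b - A * E0.
  by rewrite -mulrBr ler_wpM2l// ltW.
have H5 : b ^+ 2 / 2 * (D * expR (36 * b ^+ 2)) <= b ^+ 2 * (D / 2) + 288 * b ^+ 4.
  apply: (@le_trans _ _ (b ^+ 2 / 2 * (D * (1 + 72 * b ^+ 2)))).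
    by rewrite ler_wpM2l ?divr_ge0 ?(ltW bb0)// ler_wpM2l// ltW.
  rewrite (_ : b ^+ 4 = b ^+ 2 * b ^+ 2); last ring.
  nra.
rewrite -subr_gt0.
suff : 0 < b ^+ 2 * (d - (6 / t ^+ 3 + 354) * b).
  move=> h; apply: (lt_le_trans h).
  rewrite /d; nra.
by rewrite mulr_gt0// subr_gt0.
Qed.

(** * The counterexample *)

Definition mfun_of {d d'} {T : measurableType d} {T' : measurableType d'}
    {f : T -> T'} (mf : measurable_fun setT f) : {mfun T >-> T'} :=
  HB.pack f (isMeasurableFun.Build _ _ _ _ f mf).

Lemma ge0_integral_fst {d1 d2} {T1 : measurableType d1}
    {T2 : measurableType d2} {R : realType}
    (P1 : probability T1 R) (P2 : probability T2 R)
    (h : T1 -> \bar R) :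
  measurable_fun setT h -> (forall x, 0 <= h x)%E ->
  (\int[P1 \x P2]_w h w.1 = \int[P1]_x h x)%E.
Proof.
move=> mh h0.
have mh1 : measurable_fun setT (fun w : T1 * T2 => h w.1).
  exact: measurableT_comp.
rewrite (fubini_tonelli1 _ mh1)//=; apply: eq_integral => x _.
rewrite /fubini_F /=.
transitivity (h x * P2 setT)%E; last by rewrite probability_setT mule1.
exact: (@integral_cst _ _ _ P2 setT measurableT (h x)).
Qed.

Lemma ge0_integral_snd {d1 d2} {T1 : measurableType d1}
    {T2 : measurableType d2} {R : realType}
    (P1 : probability T1 R) (P2 : probability T2 R)
    (h : T2 -> \bar R) :
  measurable_fun setT h -> (forall x, 0 <= h x)%E ->
  (\int[P1 \x P2]_w h w.2 = \int[P2]_x h x)%E.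
Proof.
move=> mh h0.
have mh2 : measurable_fun setT (fun w : T1 * T2 => h w.2).
  exact: measurableT_comp.
rewrite (fubini_tonelli1 _ mh2)//= /fubini_F/=.
transitivity (\int[P2]_x h x * P1 setT)%E.
  exact: (@integral_cst _ _ _ P1 setT measurableT (\int[P2]_x h x)%E).
by rewrite probability_setT mule1.
Qed.

Lemma product_fst d1 d2 (T1 : measurableType d1) (T2 : measurableType d2)
    (R : realType) (P1 : probability T1 R) (P2 : probability T2 R) (A : set T1) :
  measurable A -> (P1 \x P2)%E (fst @^-1` A) = P1 A.
Proof.
move=> mA; rewrite (_ : fst @^-1` A = A `*` setT).
  rewrite product_measure1E// -[RHS]mule1; congr (_ * _)%E.
  exact: probability_setT.
by apply/seteqP; split => -[x y]/=; [|case].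
Qed.

Lemma product_snd d1 d2 (T1 : measurableType d1) (T2 : measurableType d2)
    (R : realType) (P1 : probability T1 R) (P2 : probability T2 R) (A : set T2) :
  measurable A -> (P1 \x P2)%E (snd @^-1` A) = P2 A.
Proof.
move=> mA; rewrite (_ : snd @^-1` A = setT `*` A).
  rewrite product_measure1E// -[RHS]mul1e; congr (_ * _)%E.
  exact: probability_setT.
by apply/seteqP; split => -[x y]/=; [|case].
Qed.

Lemma Hplus_pospart_powR (R : realType) (p t : R) :
  Hplus p (fun u => pospart (u - t) `^ p).
Proof.
exists (@dirac _ (measurableTypeR R) t R) => u.
rewrite integral_dirac//= ?diracT ?mul1e//.
apply/measurable_EFinP; apply: measurable_pospart_powR.
exact: measurable_funB.
Qed.

Theorem proposition2p5 (R : realType) (p : R) (p_gt0 : 0 < p) (p_lt3 : p < 3) :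
  exists sigma y beta : R, [/\ 0 < sigma, 0 < y & 0 < beta] /\
  let eps := beta / (sigma ^+ 2 * y) in
  let theta := eps * sigma ^+ 2 / y ^+ 2 in
  0 < eps < 1 /\
  exists (d : measure_display) (T : measurableType d) (P : probability T R)
         (X G : {RV P >-> R}) (N : {RV P >-> nat}) (f : R -> R),
  [/\ ('E_P[(fun w => X w ^+ 2)%R] <= (sigma ^+ 2)%:E)%E,
      ('E_P[(fun w => pospart (X w) ^+ 3)%R] <= beta%:E)%E,
      ('E_P[X] <= 0)%E &
      {ae P, forall w, X w <= y}] /\
  [/\ is_normal0 G ((1 - eps) * sigma ^+ 2),
      is_poisson N theta &
      independent_RV G N] /\
  Hplus p f /\
  ('E_P[(fun w => f (G w + y * ((N w)%:R - theta)))%R] < 'E_P[f \o X])%E.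
Proof.
have [t [t0 t2 td]] := exists_threshold p_gt0 p_lt3.
pose d := (1 - t) `^ p * (1 + p) - 2 `^ p / 2.
have d0 : 0 < d by rewrite subr_gt0.
have [b [b0 b40 bd]] : exists b : R, [/\ 0 < b, b <= 40^-1 &
    (6 / t ^+ 3 + 354) * b < d].
  have K0 : 0 < 6 / t ^+ 3 + 354.
    have : 0 < 6 / t ^+ 3 by rewrite divr_gt0// exprn_gt0.
    lra.
  set K := 6 / t ^+ 3 + 354 in K0 *; clearbody K.
  exists (Num.min 40^-1 (d / (2 * K))); split.
  - by rewrite lt_min invr_gt0 ltr0n/= divr_gt0// mulr_gt0.
  - by rewrite ge_min lexx.
  - apply: (@le_lt_trans _ _ (K * (d / (2 * K)))).
      by rewrite ler_wpM2l ?(ltW K0)// ge_min lexx orbT.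
    rewrite (_ : K * _ = d / 2); last by field; rewrite gt_eqF.
    by rewrite ltr_pdivrMr// ltr_pMr// ltr1n.
have b1 : 0 < 1 - b by lra.
have s0 : 0 < b / (1 - b) by rewrite divr_gt0.
exists (Num.sqrt (b / (1 - b))), 1, b.
split; first by rewrite sqrtr_gt0.
rewrite sqr_sqrtr ?(ltW s0)// => eps theta.
have epsE : eps = 1 - b by rewrite /eps; field; rewrite !gt_eqF.
have thetaE : theta = b by rewrite /theta epsE; field; rewrite gt_eqF.
have varE : (1 - eps) * (b / (1 - b)) = b ^+ 2 / (1 - b).
  by rewrite epsE; field; rewrite gt_eqF.
rewrite varE thetaE epsE.
split; first by apply/andP; split; lra.
pose s := Num.sqrt (b ^+ 2 / (1 - b)).
(* The carrier of the Gaussian factor is the Borel copy [measurableTypeR R] of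
   [R], on which [normal_prob] is a measure; it has the same measurable sets
   as [R] but another display, hence the measurable identity [mid] below. *)
pose P1 : probability (nat * measurableTypeR R)%type R :=
  (poisson_prob b 0 \x normal_prob 0 s)%E.
pose P : probability ((nat * measurableTypeR R) * bool)%type R :=
  (P1 \x bernoulli_prob b)%E.
pose x0 (c : bool) : R := if c then 1 else - (b / (1 - b)).
have mX : measurable_fun setT
    (x0 \o (snd : (nat * measurableTypeR R) * bool -> bool)).
  exact: measurableT_comp.
have mid : measurable_fun setT (idfun : measurableTypeR R -> R).
  exact: (@measurable_id _ _ setT).
have mG : measurable_fun setT
    ((fun w => w.1.2) : (nat * measurableTypeR R) * bool -> R).
  by apply: (measurableT_comp mid); apply: measurableT_comp.
have mN : measurable_fun setT
    ((fun w => w.1.1) : (nat * measurableTypeR R) * bool -> nat).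
  by apply: measurableT_comp.
have b01 : 0 <= b <= 1 by apply/andP; split; lra.
have EX (g : R -> R) : (forall x, 0 <= g x) ->
    (\int[P]_w (g (x0 w.2))%:E = (b * g 1 + (1 - b) * g (- (b / (1 - b))))%:E)%E.
  move=> g0; have g0' c : (0 <= (g (x0 c))%:E)%E by rewrite lee_fin.
  rewrite (ge0_integral_snd P1 (bernoulli_prob b) (fun c => (g (x0 c))%:E))//.
  by rewrite integral_bernoulli_prob.
have Pfst C : measurable C -> P (fst @^-1` C) = P1 C by exact: product_fst.
exists _, _, P, (mfun_of mX), (mfun_of mG),
  (mfun_of mN), (fun u => pospart (u - t) `^ p).
split; last split; last split.
- split.
  + rewrite unlock (EX (fun x => x ^+ 2))//=; last by move=> x; exact: sqr_ge0.
    rewrite lee_fin le_eqVlt; apply/orP; left; apply/eqP; field.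
    by rewrite gt_eqF.
  + rewrite unlock (EX (fun x => pospart x ^+ 3))//=; last first.
      by move=> x; rewrite exprn_ge0// le_max lexx.
    rewrite lee_fin /pospart (max_idPr ler01) (max_idPl _); last first.
      by rewrite oppr_le0 ltW.
    by rewrite expr1n expr0n/= mulr0 addr0 mulr1.
  (* the sign of [X] varies, and its positive and negative parts both have
     expectation [b] *)
  + rewrite unlock integralE.
    under eq_integral do rewrite funeposE -EFin_max.
    under [X in (_ - X)%E]eq_integral do rewrite funenegE -EFinN -EFin_max.
    rewrite (EX (fun x => Num.max x 0)); last first.
      by move=> x; rewrite le_max lexx orbT.
    rewrite (EX (fun x => Num.max (- x) 0)); last first.
      by move=> x; rewrite le_max lexx orbT.
    rewrite opprK (max_idPl ler01) (max_idPr (lerN10 R)) (max_idPl (ltW s0)).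
    rewrite (max_idPr _) ?oppr_le0 ?(ltW s0)//.
    rewrite -EFinB lee_fin le_eqVlt; apply/orP; left; apply/eqP; field.
    by rewrite gt_eqF.
  + by apply: aeW => w /=; rewrite /x0; case: ifP => // _; lra.
- have lawG : is_normal0 (P := P) (mfun_of mG) (b ^+ 2 / (1 - b)).
    move=> A mA.
    have mC : measurable ((snd : nat * measurableTypeR R -> _) @^-1` A).
      by rewrite -[X in measurable X]setTI; exact: measurable_snd.
    apply: (etrans (Pfst _ mC)).
    exact: product_snd.
  have lawN : is_poisson (P := P) (mfun_of mN) b.
    move=> A mA.
    have mC : measurable ((fst : nat * measurableTypeR R -> _) @^-1` A).
      by rewrite -[X in measurable X]setTI; exact: measurable_fst.
    apply: (etrans (Pfst _ mC)).
    exact: product_fst.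
  split=> // A B mA mB.
  have mC : measurable (B `*` A : set (nat * measurableTypeR R)).
    exact: measurableX.
  have -> : P (mfun_of mG @^-1` A `&` mfun_of mN @^-1` B) = P1 (B `*` A).
    rewrite -(Pfst _ mC); congr (P _).
    by apply/seteqP; split => -[[k x] c] /= [].
  have -> : P (mfun_of mG @^-1` A) = normal_prob 0 s A by exact: lawG.
  have -> : P (mfun_of mN @^-1` B) = poisson_prob b 0 B by exact: lawN.
  rewrite muleC; exact: product_measure1E.
- exact: Hplus_pospart_powR.
rewrite [in ltRHS]unlock (EX (fun x => pospart (x - t) `^ p)); last first.
  by move=> x; exact: powR_ge0.
rewrite unlock.
pose h (w : nat * measurableTypeR R) :=
  (pospart (w.2 + (w.1%:R - b) - t) `^ p)%:E.
have mh : measurable_fun setT h.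
  apply: measurable_payoff; last exact: measurable_fst.
  exact: (measurableT_comp mid measurable_snd).
have h0 w : (0 <= h w)%E by rewrite lee_fin powR_ge0.
apply: (@le_lt_trans _ _ (\int[P]_w h w.1)%E).
  by under eq_integral do rewrite /= mul1r.
rewrite (ge0_integral_fst P1 (bernoulli_prob b) h)//.
rewrite (fubini_tonelli1 _ mh)// /fubini_F /h /=.
apply: (le_lt_trans (poisson_normal_le 0 p_gt0 p_lt3 t0 t2 b0 b40)).
rewrite lte_fin (_ : b * _ + _ = b * (1 - t) `^ p).
  by apply: small_jump_gain => //; lra.
rewrite /pospart (max_idPr _); last lra.
rewrite (max_idPl _); last first.
  by rewrite subr_le0 (le_trans _ (ltW t0))// oppr_le0 ltW.
by rewrite powR0 ?mulr0 ?addr0// gt_eqF.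
Qed.
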